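(* Let $H$ be an $n$-cycle on the vertex set $\{1,\dots,n\}$, with the vertices placed at equally spaced points on a circle $C$ in the clockwise order given by $H$. Let $a,b,c$ be distinct vertices. Then the 3-cycle $(a\ b\ c)$ is $H$-admissible if and only if the chords $(a,H(b))$ and $(b,H(c))$ properly intersect in $C$.
   Context: A 3-cycle $(a\ b\ c)$ is called $H$-admissible if $H(a\ b\ c)=H'$ where $H'$ is also an $n$-cycle. Here $H(a\ b\ c)$ is the permutation sending $a\mapsto H(b)$, $b\mapsto H(c)$, $c\mapsto H(a)$, and $v\mapsto H(v)$ for all other $v$. Two chords properly intersect if they intersect and have no endpoint in common.
   Formalization: The case H(c) = a is excluded: there the chords (a,H(b)) and (b,H(c)) share the endpoint a, so they never properly intersect, yet (a b c) is always H-admissible (e.g. n = 3, H = (1 2 3), a = 1, b = 2, c = 3). *)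

(* Defs.v *)
From HB Require Import structures.
From mathcomp Require Import all_boot all_order all_algebra all_fingroup.
From mathcomp Require Import all_classical all_reals all_analysis.

Set Implicit Arguments.
Unset Strict Implicit.
Unset Printing Implicit Defensive.

Import Order.TTheory GRing.Theory Num.Theory.

Local Open Scope ring_scope.
Local Open Scope classical_set_scope.

(* The vertices 1, ..., n are represented by the elements 0, ..., n-1 of 'I_n. *)
Definition is_ncycle (n : nat) (H : {perm 'I_n}) : Prop :=
  porbits H = [set [set: 'I_n]]%SET.

(* The product of permutations applies its left factor first, so this is the
   cycle a -> b -> c -> a when a, b, c are distinct, and cycle3 a b c * H sends
   a to H b, b to H c, c to H a; see mul_cycle3E. *)
Definition cycle3 (n : nat) (a b c : 'I_n) : {perm 'I_n} :=
  (tperm a b * tperm a c)%g.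

Lemma mul_cycle3E (n : nat) (H : {perm 'I_n}) (a b c : 'I_n) :
  a != b -> b != c -> a != c ->
  let H' := (cycle3 a b c * H)%g in
  [/\ H' a = H b, H' b = H c, H' c = H a &
      forall v, v != a -> v != b -> v != c -> H' v = H v].
Proof.
move=> ab bc ac /=; split=> [||| v va vb vc]; rewrite /cycle3 !permM.
- by rewrite tpermL tpermD // eq_sym.
- by rewrite tpermR tpermL.
- by rewrite (@tpermD _ a b c) // tpermR.
- by rewrite (@tpermD _ a b v) 1?eq_sym // tpermD // eq_sym.
Qed.

Definition admissible (n : nat) (H : {perm 'I_n}) (a b c : 'I_n) : Prop :=
  is_ncycle (cycle3 a b c * H)%g.

Definition circle_point (R : realType) (o : R * R) (r t : R) : R * R :=
  (o.1 + r * cos t, o.2 + r * sin t).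

(* Successive vertices of the cycle are one n-th of a turn apart; the angle
   decreases because the order is clockwise. *)
Definition clockwise_placement (R : realType) (n : nat) (H : {perm 'I_n})
    (o : R * R) (r : R) (pos : 'I_n -> R * R) : Prop :=
  exists (v0 : 'I_n) (t0 : R), forall k : nat,
    pos (iter k H v0) = circle_point o r (t0 - k%:R * (2 * pi / n%:R)).

(* Closed segment; reduced to a point when p = q. *)
Definition chord (R : realType) (p q : R * R) : set (R * R) :=
  [set x | exists2 t : R, 0 <= t <= 1 &
     x = ((1 - t) * p.1 + t * q.1, (1 - t) * p.2 + t * q.2)].

(* For an n-cycle H and distinct a, b, c, the chords (a, H b) and (b, H c) have
   an endpoint in common exactly when H c = a. They then do not properly
   intersect, although the 3-cycle (a b c) is H-admissible (for instance
   H = (1 2 3), a = 1, b = 2, c = 3); hence the hypothesis H c <> a in the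
   equivalence between the two properties. *)
Definition properly_intersect (R : realType) (p q p' q' : R * R) : Prop :=
  (chord p q `&` chord p' q' !=set0) /\
  [/\ p <> p', p <> q', q <> p' & q <> q'].

(* Main.v *)
(** Number the vertices from [a] along [H]: [a = v 0], [b = v i], [c = v j] with
[0 < i, j < n].  If [i < j], then [H'] runs through [0, i+1, ..., j, 1, ..., i,
j+1, ..., n-1] and is an [n]-cycle; if [j < i], then [{0, i+1, ..., n-1}] is
stable under [H'] and misses [b].  On the circle, the chords are [(0, i+1)] and
[(i, j+1)]: they interleave if [i < j], and the second lies strictly on one side
of the first if [j < i]. *)

Require Import Defs.
From HB Require Import structures.
From mathcomp Require Import all_boot all_order all_algebra all_fingroup.
From mathcomp Require Import all_classical all_reals all_analysis.
From mathcomp Require Import ring lra.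

Local Open Scope ring_scope.

Import Order.TTheory GRing.Theory Num.Theory.

(** * Chords of a circle given by the angles of their endpoints *)

Section Circle.
Local Open Scope classical_set_scope.
Variables (R : realType) (o : R * R) (r : R).
Hypothesis r_gt0 : 0 < r.

Lemma cosB_sin (x d : R) :
  cos d - cos x = 2 * sin ((x + d) / 2) * sin ((x - d) / 2).
Proof.
set u := (x + d) / 2; set v := (x - d) / 2.
have -> : d = u - v by rewrite /u /v; field.
have -> : x = u + v by rewrite /u /v; field.
by rewrite cosB cosD; ring.
Qed.

(** On the unit circle the left side is twice the signed area of an inscribed triangle with
    successive arcs [2 * X] and [2 * Y]; the product form makes its sign readable. *)
Lemma sin_area (X Y : R) :
  sin (2 * X) + sin (2 * Y) - sin (2 * X + 2 * Y) =
  4 * sin X * sin Y * sin (X + Y).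
Proof.
rewrite !mulr2n !mulrDl !mul1r !sinD !cosD.
have HX := cos2Dsin2 X; have HY := cos2Dsin2 Y.
have eX : cos X * cos X = 1 - sin X * sin X by rewrite -[cos X * cos X]expr2 -HX; ring.
have eY : cos Y * cos Y = 1 - sin Y * sin Y by rewrite -[cos Y * cos Y]expr2 -HY; ring.
by rewrite eX eY; ring.
Qed.

(** Twice the signed area of the triangle [p q x]: its sign tells the side of the line [p q] on
    which [x] lies. *)
Definition cross (p q x : R * R) : R :=
  (q.1 - p.1) * (x.2 - p.2) - (q.2 - p.2) * (x.1 - p.1).

Lemma chords_meet (p q p' q' : R * R) :
  cross p' q' p < 0 -> 0 < cross p' q' q ->
  0 < cross p q p' -> cross p q q' < 0 ->
  chord p q `&` chord p' q' !=set0.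
Proof.
move=> hp hq hp' hq'.
set d := cross p q p' - cross p q q'.
have d_gt0 : 0 < d by rewrite /d; lra.
have dE : d = cross p' q' q - cross p' q' p by rewrite /d /cross; ring.
have d0 : d != 0 by rewrite gt_eqF.
(* [cross p' q'] is affine along the first chord and vanishes at parameter [t]; [cross p q] vanishes
   at parameter [s] of the second. By [dE] both have denominator [d]. *)
pose t := - cross p' q' p / d; pose s := cross p q p' / d.
exists ((1 - t) * p.1 + t * q.1, (1 - t) * p.2 + t * q.2); split.
  exists t => //; apply/andP; split.
    by rewrite /t divr_ge0 //; lra.
  by rewrite /t ler_pdivrMr // dE; lra.
exists s; first apply/andP; first split.
- by rewrite /s divr_ge0 //; lra.
- by rewrite /s ler_pdivrMr // /d; lra.
by congr pair; rewrite /s /t; move: d0; rewrite /d /cross => d0; field.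
Qed.

Lemma cross_circle (x y z : R) :
  cross (circle_point o r x) (circle_point o r y) (circle_point o r z) =
  4 * r ^+ 2 * sin ((y - x) / 2) * sin ((z - y) / 2) * sin ((z - x) / 2).
Proof.
have -> : (z - x) / 2 = (y - x) / 2 + (z - y) / 2 by field.
have := sin_area ((y - x) / 2) ((z - y) / 2).
have -> : 2 * ((y - x) / 2) = y - x by field.
have -> : 2 * ((z - y) / 2) = z - y by field.
have -> : y - x + (z - y) = z - x by ring.
move=> h.
rewrite [RHS](_ : _ = r ^+ 2 * (4 * sin ((y - x) / 2) * sin ((z - y) / 2) *
  sin ((y - x) / 2 + (z - y) / 2))); last by ring.
rewrite -h /cross /circle_point /=.
rewrite !sinB; ring.
Qed.

Lemma sin_half_gt0 (x : R) : 0 < x -> x < 2 * pi -> 0 < sin (x / 2).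
Proof.
by move=> x0 x2; apply: sin_gt0_pi; apply/andP; split; lra.
Qed.

Lemma interleaved_chords_meet (x u y v : R) :
  u < x -> y < u -> v < y -> x - 2 * pi < v ->
  chord (circle_point o r x) (circle_point o r y) `&`
  chord (circle_point o r u) (circle_point o r v) !=set0.
Proof.
move=> ux yu vy xv.
have r2 : 0 < 4 * r ^+ 2 by rewrite mulr_gt0 // exprn_gt0.
have S (z w : R) : w < z -> z - w < 2 * pi -> 0 < sin ((z - w) / 2).
  by move=> *; apply: sin_half_gt0 => //; lra.
have N (z w : R) : sin ((z - w) / 2) = - sin ((w - z) / 2).
  by rewrite -sinN; congr sin; field.
have Sxu : 0 < sin ((x - u) / 2) by apply: S; lra.
have Sxy : 0 < sin ((x - y) / 2) by apply: S; lra.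
have Sxv : 0 < sin ((x - v) / 2) by apply: S; lra.
have Suy : 0 < sin ((u - y) / 2) by apply: S; lra.
have Suv : 0 < sin ((u - v) / 2) by apply: S; lra.
have Syv : 0 < sin ((y - v) / 2) by apply: S; lra.
(* Each sign is the parity of the number of differences to be reversed, since a larger minus a
   smaller angle has a half in [(0, pi)]. *)
apply: chords_meet; rewrite cross_circle.
- by rewrite (N v u) !mulrN !mulNr oppr_lt0 !mulr_gt0.
- by rewrite (N v u) (N y u) !(mulrN, mulNr) opprK !mulr_gt0.
- by rewrite (N y x) (N u x) !(mulrN, mulNr) opprK !mulr_gt0.
- by rewrite (N y x) (N v x) (N v y) !(mulrN, mulNr) opprK oppr_lt0 !mulr_gt0.
Qed.

(* The projection onto the direction bisecting the arc [y, x] is constant on the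
   first chord and strictly larger on the second; unlike the equation of the line
   through the endpoints, this covers the degenerate case y = x - 2 pi. *)
Lemma nested_chords_disjoint (x u v y : R) :
  x - 2 * pi <= y -> y < u < x -> y < v < x ->
  ~ (chord (circle_point o r x) (circle_point o r y) `&`
     chord (circle_point o r u) (circle_point o r v) !=set0).
Proof.
move=> yx hu hv [z [[t /andP[t0 t1] ->] [s /andP[s0 s1] [e1 e2]]]].
pose m := (x + y) / 2; pose d := (x - y) / 2.
pose L (w : R) := cos w * cos m + sin w * sin m.
have LE w : L w = cos (w - m) by rewrite /L cosB.
have Lx : L x = cos d by rewrite LE; congr cos; rewrite /m /d; field.
have Ly : L y = cos d.
  by rewrite LE -cosN; congr cos; rewrite /m /d; field.
have Lw w : y < w < x -> cos d < L w.
  move=> /andP[yw wx]; rewrite LE -subr_gt0 cosB_sin.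
  have -> : d + (w - m) = w - y by rewrite /m /d; field.
  have -> : d - (w - m) = x - w by rewrite /m /d; field.
  by rewrite !mulr_gt0 //; apply: sin_half_gt0; lra.
(* Both sides are the projection of the common point, taken relative to [o] and divided by [r]. *)
have E : (1 - t) * L x + t * L y = (1 - s) * L u + s * L v.
  apply: (mulfI (lt0r_neq0 r_gt0)).
  transitivity ((((1 - t) * (o.1 + r * cos x) + t * (o.1 + r * cos y)) - o.1) * cos m +
    (((1 - t) * (o.2 + r * sin x) + t * (o.2 + r * sin y)) - o.2) * sin m).
    by rewrite /L; ring.
  by rewrite e1 e2 /L; ring.
have := Lw _ hu; have := Lw _ hv; rewrite Lx Ly in E => lv lu.
have : 0 < (1 - s) * (L u - cos d) + s * (L v - cos d).
  have [s_gt0|s_le0] := ltP 0 s.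
    by rewrite ltr_wpDl ?mulr_gt0 ?mulr_ge0 ?subr_ge0 ?subr_gt0 // ltW.
  by rewrite (_ : s = 0) ?subr0 ?mul1r ?mul0r ?addr0 ?subr_gt0 //; lra.
lra.
Qed.

End Circle.

(** * Admissibility read on the indices along the cycle *)

Section Cycles.
Variables (n : nat).
Implicit Type H : {perm 'I_n}.

Lemma ncycle_porbit H x : is_ncycle H -> porbit H x = [set: 'I_n]%SET.
Proof.
by move=> hH; apply/set1P; rewrite -hH; apply: imset_f; rewrite inE.
Qed.

Lemma porbit_ncycle H x : porbit H x = [set: 'I_n]%SET -> is_ncycle H.
Proof.
move=> hx; apply/setP => A; rewrite inE.
apply/imsetP/eqP => [[y _ ->]|->]; last by exists x.
by rewrite -hx; apply/eqP; rewrite eq_porbit_mem hx inE.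
Qed.

Lemma closed_porbit H x (A : {set 'I_n}) :
  x \in A -> (forall y, y \in A -> H y \in A) -> {subset porbit H x <= A}.
Proof.
move=> xA HA _ /porbitP[i ->]; elim: i => [|i IH]; first by rewrite expg0 perm1.
by rewrite expgSr permM HA.
Qed.

Lemma perm_porbit H x y : y \in porbit H x -> H y \in porbit H x.
Proof. by move=> /porbitP[i ->]; rewrite -permM -expgSr mem_porbit. Qed.

Section NCycle.
Variables (H : {perm 'I_n}) (a : 'I_n).
Hypothesis hH : is_ncycle H.
Local Notation v k := (iter k H a).

Lemma card_ncycle : #|porbit H a| = n.
Proof. by rewrite (ncycle_porbit _ _ hH) cardsT card_ord. Qed.

Lemma iter_ncycle : v n = a.
Proof. by have := iter_porbit H a; rewrite card_ncycle. Qed.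

Lemma iter_ncycle_inj k l : (k < n)%N -> (l < n)%N -> v k = v l -> k = l.
Proof.
move=> kn ln e; have := uniq_traject_porbit H a; rewrite card_ncycle => U.
have := nth_uniq a _ _ U; rewrite size_traject => /(_ k l kn ln).
by rewrite !nth_traject // e eqxx => /esym/eqP.
Qed.

Lemma ncycle_iter x : exists2 k, (k < n)%N & x = v k.
Proof.
have : x \in porbit H a by rewrite (ncycle_porbit _ _ hH) inE.
by rewrite porbit_traject card_ncycle => /trajectP.
Qed.

Lemma admissible_iter i j : (0 < i < n)%N -> (0 < j < n)%N -> i != j ->
  admissible H a (v i) (v j) <-> (i < j)%N.
Proof.
move=> /andP[i0 i_n] /andP[j0 j_n] ij.
have n0 : (0 < n)%N by apply: leq_trans i_n.
have neq k l : (k < n)%N -> (l < n)%N -> k != l -> v k != v l.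
  by move=> kn ln; apply: contra => /eqP/iter_ncycle_inj -> //.
have ai : a != v i by rewrite (neq 0%N) // eq_sym -lt0n.
have aj : a != v j by rewrite (neq 0%N) // eq_sym -lt0n.
have [H'a H'b H'c H'v] := mul_cycle3E H ai (neq _ _ i_n j_n ij) aj.
rewrite /admissible; set H' := (_ * H)%g in H'a H'b H'c H'v *.
have H'k k : (0 < k < n)%N -> k != i -> k != j -> H' (v k) = v k.+1.
  move=> /andP[k0 kn] ki kj; rewrite iterS H'v //; try exact: neq.
  by rewrite (neq _ 0%N) // -lt0n.
split=> [adm | lt_ij].
  rewrite ltnNge; apply/negP => le_ji.
  have lt_ji : (j < i)%N by rewrite ltn_neqAle eq_sym ij.
  (* Indices go up to [n], so that [a] enters as [v n] and the stable set becomes one interval of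
     indices. *)
  pose A := [set x | [exists k : 'I_n.+1, (i < k)%N && (x == v k)]]%SET.
  have inA k : (i < k <= n)%N -> v k \in A.
    move=> /andP[ik kn]; rewrite inE; apply/existsP.
    by exists (Ordinal (kn : (k < n.+1)%N)); rewrite /= ik eqxx.
  have aA : a \in A by rewrite -[a]iter_ncycle inA // i_n leqnn.
  have HA y : y \in A -> H' y \in A.
    rewrite inE => /existsP[[k /= kn] /andP[ik /eqP ->]].
    move: kn; rewrite ltnS leq_eqVlt => /orP[/eqP ->|kn].
      by rewrite iter_ncycle H'a -iterS inA // ltnS leqnn.
    rewrite H'k ?inA //; first by rewrite leqW.
    - by rewrite kn (leq_trans _ ik).
    - by rewrite gtn_eqF.
    - by rewrite gtn_eqF // (ltn_trans lt_ji).
  have viA : v i \in A.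
    by apply: closed_porbit aA HA _ _; rewrite (ncycle_porbit _ _ adm) inE.
  move: viA; rewrite inE => /existsP[[k /= kn] /andP[ik /eqP e]].
  move: kn; rewrite ltnS leq_eqVlt => /orP[/eqP kn|kn].
    by move: ai; rewrite e kn iter_ncycle eqxx.
  by move: ik; rewrite (iter_ncycle_inj _ _ i_n kn e) ltnn.
apply: (@porbit_ncycle _ a); set O := porbit H' a.
(* [H'] agrees with [H] away from indices [0], [i], [j], so an orbit entering a block at its first
   vertex runs through to its end. The three blocks below come in the order in which [H'] visits
   them. *)
have run l m : v l.+1 \in O -> (m <= n)%N ->
    (forall k, (l < k < m)%N -> (k != i) && (k != j)) ->
    forall k, (l < k <= m)%N -> v k \in O.
  move=> vl mn hlm; elim=> // k IH /andP[lk km].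
  move: lk; rewrite ltnS leq_eqVlt => /orP[/eqP <- //|lk].
  have /andP[ki kj] := hlm k (introT andP (conj lk km)).
  rewrite -H'k ?perm_porbit ?IH ?lk ?(ltnW km) //.
  by rewrite (leq_ltn_trans _ lk) // (leq_trans km).
have O1 : forall k, (i < k <= j)%N -> v k \in O.
  apply: run => [||k /andP[ik kj]]; last by rewrite gtn_eqF // ltn_eqF.
    by rewrite iterS -H'a perm_porbit // porbit_id.
  exact: ltnW.
have O2 : forall k, (0 < k <= i)%N -> v k \in O.
  apply: run => [||k /andP[k0 ki]].
  - by rewrite iterS /= -H'c perm_porbit // O1 // lt_ij leqnn.
  - exact: ltnW.
  - by rewrite !ltn_eqF // (ltn_trans ki).
have O3 : forall k, (j < k <= n)%N -> v k \in O.
  apply: run => [||k /andP[jk kn]] //.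
    by rewrite iterS -H'b perm_porbit // O2 // i0 leqnn.
  by rewrite !gtn_eqF // (ltn_trans lt_ij).
apply/setP => x; rewrite [RHS]inE; have [k kn ->] := ncycle_iter x.
case: (posnP k) => [->|k0]; first exact: porbit_id.
case: (leqP k i) => [ki|ik]; first by rewrite O2 // k0.
case: (leqP k j) => [kj|jk]; first by rewrite O1 // ik.
by rewrite O3 // jk ltnW.
Qed.

End NCycle.
End Cycles.

(** * From indices to chords *)

Theorem mainTheorem2 (R : realType) (n : nat) (H : {perm 'I_n})
    (hH : is_ncycle H)
    (o : R * R) (r : R) (hr : 0 < r)
    (pos : 'I_n -> R * R) (hpos : clockwise_placement H o r pos)
    (a b c : 'I_n) (hab : a <> b) (hbc : b <> c) (hac : a <> c)
    (hca : H c <> a) :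
  admissible H a b c <->
  properly_intersect (pos a) (pos (H b)) (pos b) (pos (H c)).
Proof.
have [i i_n bE] := ncycle_iter n H a hH b.
have [j j_n cE] := ncycle_iter n H a hH c.
have n0 : (0 < n)%N by apply: leq_trans i_n.
have i0 : (0 < i)%N by rewrite lt0n; apply/eqP => i0; apply: hab; rewrite bE i0.
have j0 : (0 < j)%N by rewrite lt0n; apply/eqP => j0; apply: hac; rewrite cE j0.
have ij : i != j by apply/eqP => ij; apply: hbc; rewrite bE cE ij.
(* [H c <> a] keeps the endpoint [H c] from wrapping round to index [0]. *)
have jn : (j.+1 < n)%N.
  rewrite ltn_neqAle j_n andbT; apply/eqP => jn.
  by apply: hca; rewrite cE -iterS jn iter_ncycle.
have [t posE] : exists t : R, forall k,
    pos (iter k H a) = circle_point o r (t - k%:R * (2 * pi / n%:R)).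
  have [v0 [t0 h]] := hpos; have [s _ aE] := ncycle_iter n H v0 hH a.
  exists (t0 - s%:R * (2 * pi / n%:R)) => k.
  by rewrite aE -iterD h natrD; congr circle_point; ring.
set tau := 2 * pi / n%:R in posE.
have nR : (0 : R) < n%:R by rewrite ltr0n.
have tau_gt0 : 0 < tau by rewrite divr_gt0 // mulr_gt0 // pi_gt0.
have ntau : n%:R * tau = 2 * pi by rewrite mulrC divfK // gt_eqF.
have lt_ang k l : (k < l)%N -> t - l%:R * tau < t - k%:R * tau.
  by move=> kl; rewrite ltrD2l ltrN2 ltr_pM2r // ltr_nat.
have le_ang k l : (k <= l)%N -> t - l%:R * tau <= t - k%:R * tau.
  by move=> kl; rewrite lerD2l lerN2 ler_pM2r // ler_nat.
(* The case [m = n] is the chord reduced to the point [a], which arises when [H b = a]. *)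
have disj k l m : (0 < k < m)%N -> (0 < l < m)%N -> (m <= n)%N ->
    ~ (chord (pos a) (pos (iter m H a)) `&`
       chord (pos (iter k H a)) (pos (iter l H a)) !=set0)%classic.
  move=> /andP[k0 km] /andP[l0 lm] mn; rewrite -[a in pos a]/(iter 0 H a) !posE.
  apply: nested_chords_disjoint; rewrite ?lt_ang //.
  have := le_ang _ _ mn; rewrite ntau; lra.
have inj k l : (k < n)%N -> (l < n)%N -> k != l ->
    pos (iter k H a) <> pos (iter l H a).
  wlog kl : k l / (k < l)%N.
    move=> W kn ln; rewrite neq_ltn => /orP[kl|lk].
      by apply: W; rewrite // ltn_eqF.
    by move/esym; apply: W; rewrite // ltn_eqF.
  move=> kn ln _ e.
  have e' : pos (iter (k + n) H a) = pos (iter l H a).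
    by rewrite iterD iter_ncycle.
  (* Two one-point chords: indices [k] and [k + n], a full turn apart, and index [l] strictly
     between, taken twice. Equal positions would make them meet. *)
  apply: (@nested_chords_disjoint R o r hr (t - k%:R * tau) (t - l%:R * tau)
    (t - l%:R * tau) (t - (k + n)%:R * tau)).
  - by rewrite -ntau natrD mulrDl; lra.
  - by rewrite !lt_ang // ltn_addl.
  - by rewrite !lt_ang // ltn_addl.
  rewrite -!posE e' e; set p := pos _.
  by exists p; split; exists 0; rewrite ?lexx ?ler01 // subr0 !mul1r !mul0r !addr0;
    case: (p).
rewrite bE cE -!iterS admissible_iter ?i0 ?j0 //; split.
  move=> lt_ij; split; last first.
    split.
    - by apply: (inj 0%N); rewrite // eq_sym -lt0n.
    - exact: (inj 0%N).
    - by apply: inj; rewrite ?gtn_eqF // (leq_ltn_trans lt_ij).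
    - by apply: inj; rewrite ?eqSS // (leq_ltn_trans lt_ij).
  rewrite -[a in pos a]/(iter 0 H a) !posE.
  (* The order is [0 < i < i + 1 < j + 1 < n], with chords [(0, i + 1)] and [(i, j + 1)]. *)
  apply: interleaved_chords_meet; rewrite ?lt_ang //.
  rewrite mul0r subr0 -ntau; have := lt_ang _ _ jn; lra.
move=> [meet _]; rewrite ltnNge; apply/negP => le_ji; move: meet.
have lt_ji : (j < i)%N by rewrite ltn_neqAle eq_sym ij.
(* Both [i] and [j + 1] lie strictly between [0] and [i + 1]. *)
by apply: disj; rewrite ?i0 ?ltnS //=.
Qed.
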